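(* For every integer $d\ge 0$, $$H_d = \sum_{\delta \in \mathrm{PCom}_{\mathrm{sqf}}(d)} \frac{P_\delta}{Z_\delta}.$$
   Context: A composition of $n\ge 0$ is a finite tuple $\alpha=(\alpha_1,\dots,\alpha_l)$ of positive integers with sum $n$; the empty composition is the only composition of $0$. A polycomposition of $n$ is a sequence $\delta=(\alpha^{(1)},\alpha^{(2)},\dots)$ of (possibly empty) compositions with $\sum_{i\ge1} i|\alpha^{(i)}|=n$; write formally (not exponentiation) $\delta=(\alpha^{(1)})^1(\alpha^{(2)})^2\cdots$, omitting empty compositions. Each part $d$ of $\alpha^{(r)}$ gives a block $d^r$ of $\delta$. $\mathrm{PCom}_{\mathrm{sqf}}(d)$ is the set of square-free polycompositions of $d$: those of the form $(\alpha)^1$ with $\alpha$ a composition of $d$. For a composition $\alpha=(\alpha_1,\dots,\alpha_l)$ put $Z_\alpha=\alpha_1(\alpha_1+\alpha_2)(\alpha_1+\alpha_2+\alpha_3)\cdots(\alpha_1+\cdots+\alpha_l)$ (equal to $1$ for the empty composition), and for $\delta=(\alpha)^1$ put $Z_\delta=Z_\alpha$. Let $x_{i,j}$ ($i,j\ge 1$) be indeterminates with $\deg x_{i,j}=i$; all series have rational coefficients. $H_d$ is the sum of all monomials of degree $d$ (so $H_0=1$). For $d\ge1$, $P_d=\sum_{k\mid d}\sum_{j\ge1} k\,x_{k,j}^{d/k}$, with $k$ ranging over positive divisors of $d$. For a block $d^r$, $P_{d^r}$ is obtained from $P_d$ by replacing each $x_{i,j}$ by $x_{i,j}^r$, and $P_\delta=\prod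 P_{d^r}$ over all blocks $d^r$ of $\delta$ (counted with repetition; empty product $=1$). *)

(* Defs.v *)
From HB Require Import structures.
From mathcomp Require Import all_boot all_order all_algebra finmap.
From mathcomp Require Import boolp classical_sets functions cardinality fsbigop.
From mathcomp Require Import monalg.

Set Implicit Arguments.
Unset Strict Implicit.
Unset Printing Implicit Defensive.

Import GRing.Theory.

Local Open Scope ring_scope.
Local Open Scope classical_set_scope.

(** * Formal power series in an arbitrary family of indeterminates

  [{mseries R[[I]]}] is the commutative [R]-algebra of formal power series,
  with coefficients in [R], in commuting indeterminates indexed by [I].  A
  series is its coefficient function on the (finitely supported) monomials
  [cmonom I]; addition and scaling are pointwise and the product is the Cauchy
  product.  The type is an alias, so as not to inherit the pointwise product of
  functions. *)

Definition mseries (R : comNzRingType) (I : choiceType) := cmonom I -> R.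

Reserved Notation "{ 'mseries' R [[ I ] ] }"
  (at level 0, R, I at level 2, format "{ 'mseries'  R [[ I ] ] }").
Notation "{ 'mseries' R [[ I ] ] }" := (mseries R I) : type_scope.

HB.instance Definition _ (R : comNzRingType) (I : choiceType) :=
  GRing.Zmodule.copy {mseries R[[I]]} (cmonom I -> R).

Section Factorizations.
Variable I : choiceType.
Implicit Types m a b : cmonom I.

Definition factorizations m : set (cmonom I * cmonom I) :=
  [set p | mmul p.1 p.2 = m].

Lemma leq_mdeg m i : (m i <= mdeg m)%N.
Proof.
rewrite mdegE; have [->//|mi] := eqVneq (m i) 0%N.
by rewrite (big_fsetD1 i) ?leq_addr// -cmE_neq0.
Qed.

Lemma finite_divisors m : finite_set [set a | exists b, mmul a b = m].
Proof.
pose g (f : {ffun finsupp m -> 'I_(mdeg m).+1}) : cmonom I :=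
  mkcmonom [fsfun i : finsupp m => f i : nat | 0%N].
apply: (@sub_finite_set _ _ (g @` [set: _])); last exact/finite_image/finite_finset.
move=> a /= [b abm].
have lt_a i : (a i < (mdeg m).+1)%N.
  by rewrite ltnS (leq_trans _ (leq_mdeg m i))// -abm cmM leq_addr.
exists [ffun i => Ordinal (lt_a (val i))] => //.
apply/eqP/cmP => i; rewrite cmE fsfun_ffun; case: insubP => /= [u _ <-|iNm].
  by rewrite ffunE.
apply/esym/eqP; rewrite cmE_eq0; apply: contra iNm.
by rewrite -abm mdomD in_fsetU => ->.
Qed.

Definition divs m : seq (cmonom I) :=
  fset_set [set a | exists b, mmul a b = m].

Lemma divs_uniq m : uniq (divs m). Proof. exact: fset_uniq. Qed.

Lemma mem_divs m a : (a \in divs m) <-> exists b, mmul a b = m.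
Proof.
by rewrite /divs in_fset_set ?inE//; exact: finite_divisors.
Qed.

Lemma divsl m a b : mmul a b = m -> a \in divs m.
Proof. by move=> e; apply/mem_divs; exists b. Qed.

Lemma divsr m a b : mmul a b = m -> b \in divs m.
Proof. by rewrite mulmC; exact: divsl. Qed.

Lemma divs_trans m a c : a \in divs m -> c \in divs a -> c \in divs m.
Proof.
move=> /mem_divs[b <-] /mem_divs[d <-]; apply/mem_divs.
by exists (mmul d b); rewrite mulmA.
Qed.

End Factorizations.

Section SeriesRing.
Variables (R : comNzRingType) (I : choiceType).
Implicit Types (f g h : {mseries R[[I]]}) (m a b : cmonom I).

Definition smono a : {mseries R[[I]]} := fun m => (m == a)%:R.

Definition smul f g : {mseries R[[I]]} :=
  fun m => \sum_(p \in factorizations m) (f p.1 * g p.2).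

Lemma smulE f g m (D : seq (cmonom I)) : uniq D -> {subset divs m <= D} ->
  smul f g m = \sum_(a <- D) \sum_(b <- D | mmul a b == m) f a * g b.
Proof.
move=> uD sD; under [RHS]eq_bigr do rewrite big_mkcond.
transitivity (\sum_(p <- [seq (a, b) | a <- D, b <- D] | mmul p.1 p.2 == m)
    f p.1 * g p.2); last by rewrite big_mkcond big_allpairs_dep.
rewrite bigfs //; last 2 first.
- by apply: allpairs_uniq => // -[a b] [c d].
- move=> [a b] /= /eqP abm /negP[]; apply: allpairs_f; apply: sD.
    exact: divsl abm.
  exact: divsr abm.
by apply: eq_fsbigl; apply/seteqP; split => -[a b] /= /eqP.
Qed.

Lemma smul_divs f g m :
  smul f g m = \sum_(a <- divs m) \sum_(b <- divs m | mmul a b == m) f a * g b.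
Proof. exact/smulE/(fun _ => id)/divs_uniq. Qed.

Lemma smulC : commutative smul.
Proof.
move=> f g; apply/funext => m; rewrite !smul_divs (exchange_big_dep predT) //=.
apply: eq_bigr => b _; apply: eq_big => [a|a _]; first by rewrite mulmC.
by rewrite mulrC.
Qed.

Lemma smul1 : left_id (smono mone) smul.
Proof.
move=> f; apply/funext => m; rewrite smul_divs (bigD1_seq mone) ?divs_uniq //=; last first.
  by apply: (@divsl _ m mone m); rewrite mul1m.
rewrite [X in _ + X]big1 ?addr0 => [|a /negbTE aN1]; last first.
  by rewrite big1 // => b _; rewrite /smono aN1 mul0r.
under eq_bigl do rewrite mul1m.
rewrite -big_filter (@filter_pred1_uniq _ _ m) ?divs_uniq ?big_seq1 //.
  by rewrite /smono eqxx mul1r.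
by apply: (@divsr _ m mone m); rewrite mul1m.
Qed.

Lemma smulDl : left_distributive smul +%R.
Proof.
move=> f g h; apply/funext => m; rewrite !smul_divs.
transitivity (smul f h m + smul g h m) => //; rewrite !smul_divs -big_split.
by apply: eq_bigr => a _; rewrite -big_split; apply: eq_bigr => b _; exact: mulrDl.
Qed.

Lemma smulA : associative smul.
Proof.
have E f g h m : smul (smul f g) h m = \sum_(x <- divs m) \sum_(y <- divs m)
    \sum_(z <- divs m) if mmul (mmul x y) z == m then f x * g y * h z else 0.
  rewrite smul_divs; transitivity (\sum_(a <- divs m) \sum_(z <- divs m)
      \sum_(x <- divs m) \sum_(y <- divs m) if mmul x y == a then
        if mmul a z == m then f x * g y * h z else 0 else 0).
    apply: eq_big_seq => a am; rewrite big_mkcond; apply: eq_bigr => z _.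
    rewrite (smulE _ _ (divs_uniq m)); last by move=> c; exact: divs_trans.
    case: ifP => _; last first.
      by rewrite big1 // => x _; rewrite big1 // => y _; case: ifP.
    rewrite big_distrl; apply: eq_bigr => x _.
    by rewrite big_distrl big_mkcond; apply: eq_bigr => y _; case: ifP.
  under eq_bigr do rewrite exchange_big.
  rewrite exchange_big; apply: eq_bigr => x _.
  under eq_bigr do rewrite exchange_big.
  rewrite exchange_big; apply: eq_bigr => y _.
  rewrite exchange_big; apply: eq_bigr => z _.
  under eq_bigr do rewrite eq_sym.
  rewrite -big_mkcond -big_filter; case: (boolP (mmul x y \in divs m)) => xym.
    by rewrite filter_pred1_uniq ?divs_uniq // big_seq1.
  rewrite big_filter big1 => [|a /eqP->]; last by case: eqP => // /divsl /(negP xym).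
  by case: eqP => // /divsl /(negP xym).
move=> f g h; apply/funext => m; rewrite E smulC E.
rewrite [RHS]exchange_big; under [RHS]eq_bigr do rewrite exchange_big.
rewrite [RHS]exchange_big [RHS]exchange_big /=.
apply: eq_bigr => x _; apply: eq_bigr => y _; apply: eq_bigr => z _.
rewrite (mulmC _ z) mulmA; case: eqP => // _.
by rewrite [LHS]mulrC mulrA.
Qed.

Lemma smono1_neq0 : smono mone != 0.
Proof.
apply/eqP => /(congr1 (@^~ mone)) /eqP.
by rewrite /smono eqxx (negbTE (oner_neq0 R)).
Qed.

Definition sscale (c : R) f : {mseries R[[I]]} := fun m => c * f m.

Lemma sscaleAl (c : R) f g : sscale c (smul f g) = smul (sscale c f) g.
Proof.
apply/funext => m; rewrite /sscale !smul_divs mulr_sumr; apply: eq_bigr => a _.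
by rewrite mulr_sumr; apply: eq_bigr => b _; rewrite mulrA.
Qed.

HB.instance Definition _ := GRing.Zmodule_isComNzRing.Build
  {mseries R[[I]]} smulA smulC smul1 smulDl smono1_neq0.

Lemma sscaleA c d f : sscale c (sscale d f) = sscale (c * d) f.
Proof. by apply/funext => m; rewrite /sscale mulrA. Qed.

Lemma sscale1 : left_id 1 sscale.
Proof. by move=> f; apply/funext => m; rewrite /sscale mul1r. Qed.

Lemma sscaleDr : right_distributive sscale +%R.
Proof. by move=> c f g; apply/funext => m; apply: mulrDr. Qed.

Lemma sscaleDl f : {morph sscale^~ f : c d / c + d}.
Proof. by move=> c d; apply/funext => m; apply: mulrDl. Qed.

HB.instance Definition _ := GRing.Zmodule_isLmodule.Build R {mseries R[[I]]}
  sscaleA sscale1 sscaleDr sscaleDl.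

HB.instance Definition _ :=
  GRing.Lmodule_isLalgebra.Build R {mseries R[[I]]} sscaleAl.
HB.instance Definition _ := GRing.Lalgebra_isComAlgebra.Build R {mseries R[[I]]}.

Lemma mseriesZ (c : R) f m : (c *: f) m = c * f m.
Proof. by []. Qed.

Lemma smulME a b : smono a * smono b = smono (mmul a b).
Proof.
apply/funext => m; transitivity (smul (smono a) (smono b) m); first by [].
pose D := undup [:: a, b & divs m].
rewrite (smulE _ _ (undup_uniq [:: a, b & divs m])) -/D; last first.
  by move=> c cm; rewrite mem_undup !inE cm !orbT.
rewrite (bigD1_seq a) ?undup_uniq ?mem_undup ?inE ?eqxx //=.
rewrite [X in _ + X]big1 ?addr0 => [|c /negbTE ca]; last first.
  by rewrite big1 // => d _; rewrite /smono ca mul0r.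
rewrite big_mkcond (bigD1_seq b) ?undup_uniq ?mem_undup ?inE ?eqxx ?orbT //=.
rewrite big1 ?addr0 => [|d /negbTE db]; last first.
  by rewrite /smono db mulr0 if_same.
by rewrite /smono !eqxx mul1r eq_sym; case: ifP.
Qed.

Lemma smonoX a n : smono a ^+ n = smono (\big[mmul/mone]_(i < n) a).
Proof.
elim: n => [|n IH]; first by rewrite expr0 big_ord0.
by rewrite exprS IH smulME big_ord_recl.
Qed.

(* Sum of a possibly infinite family of series, computed coefficientwise.  It
   is meaningful for [summable] families only: a coefficient to which infinitely
   many members contribute is set to 0. *)
Definition ssum (J : choiceType) (A : set J) (F : J -> {mseries R[[I]]}) :
    {mseries R[[I]]} :=
  fun m => \sum_(j \in A) F j m.

Definition summable (J : choiceType) (A : set J) (F : J -> {mseries R[[I]]}) :=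
  forall m, finite_set [set j | A j /\ F j m != 0].

Lemma summable_smono (A : set (cmonom I)) : summable A smono.
Proof.
move=> m; apply: (@sub_finite_set _ _ [set m]); last exact: finite_set1.
by move=> a [_]; rewrite /smono; have [->|_] := eqVneq m a; rewrite /= ?eqxx.
Qed.

(* Substitution of the r-th power of x for every indeterminate x. *)
Definition spow_subst (r : nat) f : {mseries R[[I]]} :=
  ssum [set: cmonom I] (fun a => f a *: smono a ^+ r).

Lemma summable_spow_subst (r : nat) f : (0 < r)%N ->
  summable [set: cmonom I] (fun a => f a *: smono a ^+ r).
Proof.
case: r => // r _ m; apply: sub_finite_set (finite_divisors m) => a [_] /=.
rewrite smonoX big_ord_recl mseriesZ /smono; set b := mmul _ _.
have [->|_] := eqVneq m b; last by rewrite mulr0 eqxx.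
move=> _; by exists (\big[mmul/mone]_(i < r) a).
Qed.

End SeriesRing.

(** * Polycompositions *)

Definition is_composition (n : nat) (al : seq nat) : bool :=
  (0%N \notin al) && (sumn al == n).

Lemma finite_composition n : finite_set [set al | is_composition n al].
Proof.
apply: (@sub_finite_set _ _
  ((fun s : n.-bseq 'I_n.+1 => map val s) @` [set: _])); last first.
  exact/finite_image/finite_finset.
move=> al /= /andP[al0 /eqP aln].
have le_al i : i \in al -> (i < n.+1)%N.
  move=> ial; rewrite ltnS -aln sumnE (big_rem i ial).
  exact: leq_addr.
have sz_al : (size al <= n)%N.
  rewrite -aln -sum1_size sumnE big_seq [leqRHS]big_seq leq_sum // => i ial.
  by rewrite lt0n; apply: contraNneq al0 => <-.
have sz : (size (pmap (insub : nat -> option 'I_n.+1) al) <= n)%N.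
  by rewrite size_pmap (leq_trans (count_size _ _)).
exists (Bseq sz) => //=; rewrite pmap_filter; last exact: insubK.
by apply/all_filterP/allP => i /le_al; rewrite isSome_insub.
Qed.

(* A polycomposition is represented by the finitely supported function
   r |-> alpha^(r), where the index r starts at 1: its value at 0 is a dummy,
   required to be empty. *)
Definition polycomposition := {fsfun nat -> seq nat with [::]}.

Implicit Types (de : polycomposition) (al : seq nat).

Definition PCom (n : nat) : set polycomposition :=
  [set de : polycomposition |
    [/\ de 0%N = [::],
        forall r, is_composition (sumn (de r)) (de r)
      & (\sum_(r <- finsupp de) r * sumn (de r))%N = n]].

(* The polycomposition written (al)^1. *)
Definition pcom1 al : polycomposition := [fsfun [fsfun] with 1%N |-> al].

Definition PCom_sqf (n : nat) : set polycomposition :=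
  [set de | PCom n de /\ exists2 al, is_composition n al & de = pcom1 al].

Lemma PCom_sqf_pcom1 n al : is_composition n al -> PCom_sqf n (pcom1 al).
Proof.
move=> aln; split; last by exists al.
have E r : pcom1 al r = if r == 1%N then al else [::].
  by rewrite /pcom1 fsfun_withE; case: eqP => // _; rewrite fsfun0E.
split=> [|r|]; first by rewrite E.
  rewrite E; case: eqP => // _; rewrite /is_composition eqxx andbT.
  by case/andP: aln.
rewrite (big_fset_incl _ (B := [fset 1%N]%fset)) ?big_seq_fset1 ?E ?mul1n.
- by case/andP: aln => _ /eqP.
- by apply/fsubsetP => r; rewrite mem_finsupp E in_fset1; case: (r =P 1%N).
- by move=> r _; rewrite mem_finsupp negbK => /eqP->; rewrite muln0.
Qed.

Lemma finite_PCom_sqf n : finite_set (PCom_sqf n).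
Proof.
apply: sub_finite_set (finite_image pcom1 (finite_composition n)).
by move=> de [_ [al aln ->]]; exists al.
Qed.

(* The pair (d, r) stands for the block d^r. *)
Definition blocks de : seq (nat * nat) :=
  [seq (d, r) | r <- finsupp de, d <- de r].

Definition Zcom al : nat := (\prod_(i < size al) sumn (take i.+1 al))%N.

(* For square-free polycompositions only. *)
Definition Zpcom de : nat := Zcom (de 1%N).

(** * The series H and P *)

(* The pair (i, j) indexes the indeterminate x_{i+1,j+1}. *)
Definition xindex : choiceType := (nat * nat)%type.

Definition xvar (i j : nat) : {mseries rat[[xindex]]} :=
  smono rat (ucm ((i.-1, j.-1) : xindex)).

(* The degree of monomials for which x_{i,j} has degree i. *)
Definition xdeg (m : cmonom xindex) : nat :=
  (\sum_(ij <- finsupp m) m ij * ij.1.+1)%N.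

Definition Hseries (d : nat) : {mseries rat[[xindex]]} :=
  ssum [set m | xdeg m = d] (@smono rat xindex).

Definition Pseries (d : nat) : {mseries rat[[xindex]]} :=
  \sum_(k <- divisors d)
    ssum [set j | (0 < j)%N] (fun j => k%:R *: xvar k j ^+ (d %/ k)).

Lemma summable_Pseries (d k : nat) : (0 < d)%N -> k \in divisors d ->
  summable [set j | (0 < j)%N] (fun j => k%:R *: xvar k j ^+ (d %/ k)).
Proof.
move=> d0; rewrite -dvdn_divisors // => kd m.
have dk0 : (0 < d %/ k)%N.
  by rewrite divn_gt0; [exact: dvdn_leq | exact: dvdn_gt0 d0 kd].
apply: (@sub_finite_set _ _ ((fun ij : xindex => ij.2.+1) @` [set` finsupp m])).
  move=> j [/= j0]; rewrite smonoX mseriesZ /smono; set b := \big[_/_]_(_ < _) _.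
  have [-> _|_] := eqVneq m b; last by rewrite mulr0 eqxx.
  exists (k.-1, j.-1) => /=; last by rewrite prednK.
  rewrite -cmE_neq0 {}/b; case: (d %/ k)%N dk0 => // n _.
  by rewrite big_ord_recl cmM cmUU.
exact/finite_image/finite_seq.
Qed.

Definition Pblock (b : nat * nat) : {mseries rat[[xindex]]} :=
  spow_subst b.2 (Pseries b.1).

Definition Ppcom de : {mseries rat[[xindex]]} :=
  \prod_(b <- blocks de) Pblock b.

(* Main.v *)
(* Counting, for a monomial m of degree d, the pairs (x_{i,j}, e) with e >= 1 and
   x_{i,j}^e | m, each with weight i, gives d; read coefficientwise this is
   Newton's identity  d H_d = \sum_{0 < k <= d} P_k H_{d-k}.  Removing the last
   part k of a composition of d divides Z by d, so the right-hand side of the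
   theorem satisfies the same recursion. *)
Require Import Defs.
From mathcomp Require Import all_boot all_order all_algebra finmap.
From mathcomp Require Import boolp classical_sets functions cardinality fsbigop.
From mathcomp Require Import monalg.

Set Implicit Arguments.
Unset Strict Implicit.
Unset Printing Implicit Defensive.

Import GRing.Theory Num.Theory.

Local Open Scope ring_scope.
Local Open Scope classical_set_scope.

(** * Powers and divisors of monomials *)

Section MonomialPowers.
Variable I : choiceType.
Implicit Types (a : cmonom I) (i j : I).

(** The product has the shape of the exponent in [smonoX], so powers of [smono] become
    [smono (mpow a n)] by conversion. *)
Definition mpow a n : cmonom I := \big[mmul/mone]_(k < n) a.

Lemma mpow0 a : mpow a 0 = mone.
Proof. exact: big_ord0. Qed.

Lemma mpowS a n : mpow a n.+1 = mmul a (mpow a n).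
Proof. exact: big_ord_recl. Qed.

Lemma mpowE a n i : mpow a n i = (n * a i)%N.
Proof.
elim: n => [|n IHn]; first by rewrite mpow0 cm1.
by rewrite mpowS cmM IHn mulSn.
Qed.

(** Evaluating both monomials at [j] gives the positive value [f] on the right, which excludes
    [i != j]. *)
Lemma mpow_ucm_inj i j e f : (0 < f)%N ->
  (mpow (ucm i) e == mpow (ucm j) f) = (i == j) && (e == f).
Proof.
move=> f0; apply/eqP/andP => [E|[/eqP-> /eqP->]//].
have := congr1 (fun m : cmonom I => m j) E; rewrite !mpowE !cmU eqxx muln1.
have [_|_] := eqVneq i j; first by rewrite muln1 => ->.
by rewrite muln0 => f_eq0; rewrite -f_eq0 in f0.
Qed.

Lemma mpow_ucm_divs m i e : (mpow (ucm i) e \in divs m) = (e <= m i)%N.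
Proof.
apply/idP/idP => [/mem_divs[b <-]|le_e].
  by rewrite cmM mpowE cmUU muln1 leq_addr.
apply/mem_divs.
exists (divcm m (mpow (ucm i) e)); apply/eqP/cmP => j.
rewrite cmM divcmE subnKC // mpowE cmU.
have [<-|_] := eqVneq i j; last by rewrite muln0.
by rewrite muln1.
Qed.

Lemma mmulmI a : injective (mmul a).
Proof.
move=> b c abc; apply/eqP/cmP => i; apply/(@addnI (a i)).
by rewrite -!cmM abc.
Qed.

(** Monomials cancel, so the cofactor of [a] in [m] is unique; this collapses the inner sum of a
    Cauchy product. *)
Lemma big_divs_mmul (V : nmodType) (F : cmonom I -> V) m a b : mmul a b = m ->
  \sum_(c <- divs m | mmul a c == m) F c = F b.
Proof.
move=> abm; rewrite (eq_bigl (pred1 b)) => [|c]; last first.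
  by rewrite -abm (inj_eq (@mmulmI a)).
rewrite -big_filter filter_pred1_uniq ?divs_uniq ?big_seq1 //.
exact: divsr abm.
Qed.

End MonomialPowers.

(** * The weighted degree *)

Lemma xdegEw (m : cmonom xindex) (D : {fset xindex}) : (finsupp m `<=` D)%fset ->
  xdeg m = (\sum_(ij <- D) m ij * ij.1.+1)%N.
Proof.
move=> mD; rewrite /xdeg (big_fset_incl _ mD) // => i _.
by rewrite -cmE_eq0 => /eqP->.
Qed.

Lemma xdegM (a b : cmonom xindex) : xdeg (mmul a b) = (xdeg a + xdeg b)%N.
Proof.
rewrite (xdegEw (m := a) (fsubsetUl _ (finsupp b))).
rewrite (xdegEw (m := b) (fsubsetUr (finsupp a) _)).
rewrite /xdeg mdomD -big_split; apply: eq_bigr => i _.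
by rewrite cmM mulnDl.
Qed.

Lemma xdeg_mpow (a : cmonom xindex) n : xdeg (mpow a n) = (n * xdeg a)%N.
Proof.
elim: n => [|n IHn]; last by rewrite mpowS xdegM IHn mulSn.
by rewrite mpow0 /xdeg big1 // => i _; rewrite cm1.
Qed.

Lemma xdeg_ucm (i : xindex) : xdeg (ucm i) = i.1.+1.
Proof. by rewrite /xdeg mdomU big_seq_fset1 cmUU mul1n. Qed.

Lemma xdeg_eq0 m : (xdeg m == 0)%N = (m == mone).
Proof.
apply/eqP/eqP => [m0|->]; last by rewrite -(mpow0 mone) xdeg_mpow.
apply/eqP/cmP => i; rewrite cm1; case: mdomP => // im.
move/eqP: m0; rewrite /xdeg (big_fsetD1 i) //= addn_eq0 muln_eq0 orbF.
by case/andP=> /eqP.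
Qed.

(** * Coefficients of the series H and P *)

Lemma fsbig_single (V : nmodType) (T : choiceType) (A : set T) (F : T -> V) x :
  A x -> (forall y, A y -> y != x -> F y = 0) -> \sum_(y \in A) F y = F x.
Proof.
move=> Ax F0; rewrite -(@fsbig_widen _ _ _ _ [set x] A) ?fsbig_set1 //.
  by move=> _ ->.
by move=> y [Ay /= /eqP]; exact: F0.
Qed.

Lemma mseries_sum (R : comNzRingType) (I : choiceType) (T : Type) (r : seq T)
    (P : pred T) (F : T -> {mseries R[[I]]}) m :
  (\sum_(i <- r | P i) F i) m = \sum_(i <- r | P i) F i m.
Proof. exact: (big_morph (fun f : {mseries R[[I]]} => f m)). Qed.

Lemma Hseries_coef d m : Hseries d m = (xdeg m == d)%:R.
Proof.
rewrite /Hseries /ssum; case: eqP => md.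
  rewrite (fsbig_single (x := m)) ?/smono ?eqxx // => a _.
  by rewrite eq_sym => /negbTE->.
by rewrite fsbig1 // => a /= ad; rewrite /smono; case: (m =P a) ad => // <-.
Qed.

Lemma Pseries_coefE k (a : cmonom xindex) : Pseries k a = \sum_(c <- divisors k)
  \sum_(j \in [set j | (0 < j)%N])
    (c%:R * (a == mpow (ucm ((c.-1, j.-1) : xindex)) (k %/ c))%:R : rat).
Proof.
rewrite /Pseries mseries_sum; apply: eq_bigr => c _; apply: eq_fsbigr => j _.
by rewrite smonoX.
Qed.

Lemma Pseries_coef_mpow k i e : (0 < k)%N -> (0 < e)%N ->
  Pseries k (mpow (ucm i) e) = (e * i.1.+1 == k)%N%:R * i.1.+1%:R.
Proof.
move=> k0 e0; rewrite Pseries_coefE.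
have E c j : (mpow (ucm i) e == mpow (ucm (c.-1, j.-1)) (k %/ c)) =
    (i == (c.-1, j.-1)) && (e == k %/ c)%N.
  by rewrite eq_sym mpow_ucm_inj // eq_sym (eq_sym e).
case: eqP => [ek|ek].
  have ik : i.1.+1 \in divisors k by rewrite -dvdn_divisors // -ek dvdn_mull.
  rewrite (bigD1_seq i.1.+1) ?divisors_uniq //= [X in _ + X]big1_seq ?addr0; last first.
    (* The shift [c.-1] is faithful only for positive [c]; divisors of the positive [k] are
       positive. *)
    move=> c /andP[ci]; rewrite -dvdn_divisors // => /dvdn_gt0-/(_ k0) c0.
    rewrite fsbig1 // => j _; rewrite E; case: eqP => [Ei|_]; last by rewrite mulr0.
    by move: ci; rewrite Ei /= prednK ?eqxx.
  rewrite (fsbig_single (x := i.2.+1)) // => [|j j0 jN].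
    by rewrite E /= -surjective_pairing eqxx -ek mulnK // eqxx mulr1 mul1r.
  rewrite E; case: eqP => [Ei|_]; last by rewrite mulr0.
  by move: jN; rewrite Ei /= prednK ?eqxx.
rewrite mul0r big1_seq // => c /= ck; rewrite fsbig1 // => j _; rewrite E.
case: eqP => [Ei|_]; last by rewrite mulr0.
case: eqP => [Ee|_]; last by rewrite mulr0.
(* A match would give [e = k %/ c] with [c = i.1.+1] dividing [k], hence [e * i.1.+1 = k]. *)
move: ck; rewrite -dvdn_divisors // => ck.
by case: ek; rewrite Ei Ee /= prednK ?divnK // (dvdn_gt0 k0).
Qed.

(** Every monomial of P_k is a power of a single indeterminate, with exponent [k %/ c] positive
    because [c] divides [k]. *)
Lemma Pseries_coef0 k a : (0 < k)%N ->
  (forall i e, (0 < e)%N -> a != mpow (ucm i) e) -> Pseries k a = 0.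
Proof.
move=> k0 aN; rewrite Pseries_coefE big1_seq // => c /= ck.
rewrite fsbig1 // => j _; rewrite (negbTE (aN _ _ _)) ?mulr0 //.
move: ck; rewrite -dvdn_divisors // => ck.
by rewrite divn_gt0 ?(dvdn_gt0 k0) // dvdn_leq.
Qed.

(** At most one pair [(i, e)] in the range matches [a]. The range depends on [m] only, so that this
    sum can later be exchanged with the sum over the divisors [a] of [m]. *)
Lemma Pseries_coef k m a : (0 < k)%N -> a \in divs m -> Pseries k a =
  \sum_(i <- finsupp m) \sum_(1 <= e < (m i).+1 | a == mpow (ucm i) e)
     (e * i.1.+1 == k)%N%:R * i.1.+1%:R.
Proof.
move=> k0 am; case: (pselect (exists i e, (0 < e)%N /\ a = mpow (ucm i) e)).
  move=> [i [e [e0 ae]]]; rewrite ae Pseries_coef_mpow //.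
  (* Divisibility of [m] by [a] places the matching pair inside the range of summation. *)
  have le_e : (e <= m i)%N by rewrite -mpow_ucm_divs -ae.
  have im : i \in finsupp m by rewrite -cmE_neq0 -lt0n (leq_trans e0).
  rewrite (bigD1_seq i) ?fset_uniq //= [X in _ = _ + X]big1 ?addr0; last first.
    move=> j /negbTE ji; rewrite big1 // => f.
    by rewrite eq_sym mpow_ucm_inj // ji.
  under eq_bigl do rewrite eq_sym mpow_ucm_inj // eqxx /=.
  rewrite -big_filter filter_pred1_uniq ?big_seq1 ?iota_uniq //.
  by rewrite mem_index_iota e0.
move=> aN; have {}aN i e : (0 < e)%N -> a != mpow (ucm i) e.
  by move=> e0; apply/eqP => ae; apply: aN; exists i, e.
rewrite Pseries_coef0 // big1 // => i _; rewrite big_nat_cond big1 // => e.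
by case/andP=> /andP[/aN-/(_ i)/negbTE->].
Qed.

(** P_k is homogeneous of degree [k]: the previous formula is applied to [a] as a divisor of
    itself. *)
Lemma Pseries_coef_xdeg k a : (0 < k)%N -> xdeg a != k -> Pseries k a = 0.
Proof.
move=> k0 ak; have aa : a \in divs a by apply: (@divsl _ _ _ mone); rewrite mulm1.
rewrite (Pseries_coef k0 aa) big1 // => i _; rewrite big1 // => e /eqP ae.
by move: ak; rewrite ae xdeg_mpow xdeg_ucm => /negbTE->; rewrite mul0r.
Qed.

(** * Newton's identity *)

Lemma Pseries_coef_sum m : \sum_(a <- divs m) \sum_(k < xdeg m) Pseries k.+1 a =
  (xdeg m)%:R.
Proof.
transitivity (\sum_(a <- divs m) \sum_(i <- finsupp m)
    \sum_(1 <= e < (m i).+1) (a == mpow (ucm i) e)%:R * i.1.+1%:R : rat).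
  apply: eq_big_seq => a am.
  under eq_bigr do rewrite (Pseries_coef _ am) //.
  rewrite exchange_big; apply: eq_big_seq => i im.
  rewrite exchange_big big_mkcond; apply: eq_big_nat => e /andP[e0 em] /=.
  case: eqP => _; last by rewrite mul0r.
  (* The pair [(i, e)] is met by exactly one [k], shifted by one since the series is P_(k+1). It is
     in range: as [e <= m i], the term of [i] in [xdeg m] is at least [e * i.1.+1]. *)
  have lt_e : ((e * i.1.+1).-1 < xdeg m)%N.
    rewrite prednK ?muln_gt0 ?e0 // /xdeg (big_fsetD1 i) //=.
    by rewrite (leq_trans _ (leq_addr _ _)) // leq_mul2r -ltnS em orbT.
  rewrite mul1r (bigD1 (Ordinal lt_e)) //= prednK ?muln_gt0 ?e0 // eqxx mul1r.
  rewrite big1 ?addr0 // => k /eqP kN; case: eqP => [Ek|_]; last by rewrite mul0r.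
  by case: kN; apply: val_inj; rewrite /= Ek.
rewrite exchange_big /xdeg natr_sum; apply: eq_big_seq => i im.
(* Each exponent [e] between 1 and [m i] comes from one divisor of [m], so [i] contributes its
   weight [m i] times. *)
rewrite exchange_big natrM; transitivity (\sum_(1 <= e < (m i).+1) i.1.+1%:R : rat).
  apply: eq_big_nat => e /andP[_ em].
  rewrite (bigD1_seq (mpow (ucm i) e)) ?divs_uniq ?mpow_ucm_divs //= eqxx mul1r.
  by rewrite big1 ?addr0 // => a /negbTE->; rewrite mul0r.
by rewrite sumr_const_nat subn1 mulr_natl.
Qed.

Lemma Newton_Hseries d :
  \sum_(k < d) Pseries k.+1 * Hseries (d - k.+1) = d%:R *: Hseries d.
Proof.
apply/funext => m; rewrite mseries_sum mseriesZ Hseries_coef.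
(* Where P_(k+1) does not vanish, [a] has degree [k.+1], so the cofactor [b] has degree [d - k.+1]
   exactly when [m] has degree [d]: the factor from H depends on [m] alone. *)
transitivity (\sum_(k < d) \sum_(a <- divs m) \sum_(b <- divs m | mmul a b == m)
    (xdeg m == d)%:R * Pseries k.+1 a).
  apply: eq_bigr => k _; rewrite [LHS]smul_divs; apply: eq_bigr => a _.
  apply: eq_bigr => b /eqP <-; rewrite Hseries_coef xdegM mulrC.
  have [->|ak] := eqVneq (xdeg a) k.+1; last by rewrite Pseries_coef_xdeg ?mulr0.
  by rewrite -(eqn_add2l k.+1) subnKC.
case: eqP => [<-|_]; last first.
  rewrite mulr0 big1 // => k _; rewrite big1 // => a _.
  by rewrite big1 // => b _; rewrite mul0r.
rewrite mulr1 -Pseries_coef_sum exchange_big; apply: eq_big_seq => a /mem_divs[b abm].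
by apply: eq_bigr => k _; rewrite (big_divs_mmul _ abm) mul1r.
Qed.

(** * Compositions and the recursion on the last part *)

Definition compositions d : seq (seq nat) :=
  fset_set [set al | is_composition d al].

Lemma mem_compositions d al : (al \in compositions d) = is_composition d al.
Proof.
by apply/idP/idP; rewrite /compositions in_fset_set ?inE //; exact: finite_composition.
Qed.

Lemma compositions_uniq d : uniq (compositions d).
Proof. exact: fset_uniq. Qed.

Lemma compositions0 : compositions 0 = [:: [::]].
Proof.
apply/perm_small_eq => //; apply: uniq_perm => //; first exact: compositions_uniq.
move=> al; rewrite mem_compositions inE; case: al => [|[|n] al] //=.
by rewrite /is_composition /= addSn andbF.
Qed.

(** For positive [d] the empty sequence is excluded, and splitting off the last part [k.+1] is a
    bijection. *)
Lemma perm_compositions d : (0 < d)%N -> perm_eq (compositions d)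
  [seq rcons al k.+1 | k <- iota 0 d, al <- compositions (d - k.+1)].
Proof.
move=> d0; apply: uniq_perm; first exact: compositions_uniq.
  apply: allpairs_uniq_dep; first exact: iota_uniq.
    by move=> k _; exact: compositions_uniq.
  by move=> [k al] [l be] _ _ /= /rcons_inj[-> ->].
move=> al; rewrite mem_compositions; apply/idP/allpairsPdep => /=.
  case/lastP: al => [|al k]; first by case: d d0.
  rewrite /is_composition mem_rcons inE negb_or sumn_rcons.
  case/andP=> /andP[k0 al0] /eqP ald; case: k k0 ald => // k _ ald.
  exists k, al; split=> //; first by rewrite mem_iota -ald addnS ltnS leq_addl.
  by rewrite mem_compositions /is_composition al0 -ald addnK /=.
move=> [k [be [kd be_d ->]]]; move: kd be_d; rewrite mem_iota mem_compositions /=.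
move=> kd /andP[be0 /eqP be_d]; rewrite /is_composition mem_rcons inE be0.
by rewrite sumn_rcons be_d subnK /=.
Qed.

(** The proper prefixes are prefixes of [al]; the only new factor is the total sum. *)
Lemma Zcom_rcons al k : Zcom (rcons al k) = (Zcom al * (sumn al + k))%N.
Proof.
rewrite /Zcom size_rcons big_ord_recr /= take_oversize ?size_rcons // sumn_rcons.
by congr (_ * _)%N; apply: eq_bigr => i _; rewrite -cats1 takel_cat.
Qed.

Definition Pcom al : {mseries rat[[xindex]]} := \prod_(n <- al) Pseries n.

(** The right-hand side of the theorem, indexed by the compositions themselves. *)
Definition comsum d : {mseries rat[[xindex]]} :=
  \sum_(al <- compositions d) (Zcom al)%:R^-1 *: Pcom al.

Lemma comsum_rec d : (0 < d)%N ->
  d%:R *: comsum d = \sum_(k < d) Pseries k.+1 * comsum (d - k.+1).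
Proof.
move=> d0; rewrite /comsum (perm_big _ (perm_compositions d0)) big_allpairs_dep.
rewrite -(big_mkord xpredT (fun k => Pseries k.+1 * comsum (d - k.+1))).
rewrite /index_iota subn0 scaler_sumr; apply: eq_big_seq => k.
rewrite mem_iota => /= kd; rewrite scaler_sumr mulr_sumr; apply: eq_big_seq => al.
rewrite mem_compositions => /andP[_ /eqP al_d].
(* The new factor of [Zcom] is [d], which cancels the scalar [d] on the left. *)
rewrite Zcom_rcons al_d subnK // natrM invfM mulrC scalerA mulVKf ?pnatr_eq0 -?lt0n //.
by rewrite /Pcom big_rcons /= mulrC -scalerAr.
Qed.

Lemma Hseries_comsum d : Hseries d = comsum d.
Proof.
elim/ltn_ind: d => -[_|d IHd].
  (* In degree 0 only the empty composition remains, and both sides are the unit series. *)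
  apply/funext => m; rewrite Hseries_coef /comsum compositions0 big_seq1 /Pcom big_nil.
  rewrite /Zcom big_ord0 invr1 scale1r; transitivity ((m == mone)%:R : rat) => //.
  by rewrite xdeg_eq0.
(* Newton's identity determines H only up to the factor [d.+1], which is invertible over the
   rationals. *)
apply: (@scalerI _ _ d.+1%:R); first by rewrite pnatr_eq0.
rewrite -Newton_Hseries comsum_rec //; apply: eq_bigr => k _.
by rewrite IHd // subSS ltnS leq_subr.
Qed.

(** * From compositions to square-free polycompositions *)

Lemma spow_subst1 (R : comNzRingType) (I : choiceType) (f : {mseries R[[I]]}) :
  spow_subst 1 f = f.
Proof.
apply/funext => m; rewrite /spow_subst /ssum (fsbig_single (x := m)) //.
  by rewrite mseriesZ expr1 /smono eqxx mulr1.
by move=> a _; rewrite mseriesZ expr1 /smono eq_sym => /negbTE->; rewrite mulr0.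
Qed.

Lemma pcom1E al r : pcom1 al r = if r == 1%N then al else [::].
Proof. by rewrite /pcom1 fsfun_withE fsfun0E. Qed.

Lemma pcom1_inj : injective pcom1.
Proof. by move=> al be /(congr1 (fun de : polycomposition => de 1%N)); rewrite !pcom1E. Qed.

Lemma Ppcom_pcom1 al : Ppcom (pcom1 al) = Pcom al.
Proof.
rewrite /Ppcom /blocks big_allpairs_dep.
(* The support of [pcom1 al] is empty when [al] is; enlarging it to the singleton of 1 treats both
   cases at once. *)
rewrite (big_fset_incl _ (B := [fset 1%N]%fset)) ?big_seq_fset1 ?pcom1E /=.
- by apply: eq_bigr => n _; exact: spow_subst1.
- by apply/fsubsetP => r; rewrite mem_finsupp pcom1E in_fset1; case: (r =P 1%N).
- by move=> r _; rewrite mem_finsupp negbK => /eqP->; rewrite big_nil.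
Qed.

Theorem proposition18 (d : nat) :
  Hseries d = \sum_(de \in PCom_sqf d) ((Zpcom de)%:R^-1 *: Ppcom de).
Proof.
(* [pcom1] is a bijection from the compositions of [d] onto [PCom_sqf d], which turns the sum into
   [comsum d]. *)
rewrite (@reindex_fsbig _ _ _ _ _ pcom1 [set al | is_composition d al]); last first.
  split.
  - by move=> al; exact: PCom_sqf_pcom1.
  - by move=> al be _ _; exact: pcom1_inj.
  - by move=> de [_ [al]]; exists al.
rewrite fsbig_finite; last exact: finite_composition.
rewrite Hseries_comsum; apply: eq_bigr => al _.
by rewrite Ppcom_pcom1 /Zpcom pcom1E.
Qed.
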